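(* For any interval order $P$, the set $\overrightarrow{\mathcal{E}_P}$ of characteristic vectors of the fundamental extenders of $P$ is an integral Hilbert basis for the cone $Q_P^*$.
   Context: A finite (strictly) partially ordered set $P=(X,\prec)$, $X=\{1,\dots,n\}$, is an interval order if there are compact real intervals $[\ell_x,r_x]$, $x\in X$, with $\ell_x\le r_x$, such that $x\prec y$ if and only if $r_x<\ell_y$. Interval representations are moreover required to satisfy $r_x+1\le \ell_y$ for all $x\prec y$. A natural representation is one in which all endpoints are non-negative integers. The magnitude $m$ of $P$ is the number of distinct down-sets $D(z)=\{x: x\prec z\}$, $z\in X$. The canonical representation of $P$ is the (unique) natural representation whose set of interval endpoints is $\{0,1,\dots,m-1\}$. The length polyhedron $Q_P\subset\mathbb{R}^n$ is the set of all vectors $(r_x-\ell_x)_{x\in X}$ over all interval representations of $P$ with real endpoints (satisfying $r_x+1\le\ell_y$ for all $x\prec y$). Let $\boldsymbol{\rho^*}$ be the vector of interval lengths of the canonical representation. Then $Q_P=\boldsymbol{\rho^*}+Q_P^*$, where $Q_P^*$ is a pointed rational cone; i.e. $Q_P^*=\{v-\boldsymbol{\rho^*}: v\in Q_P\}$. Let $[\ell_x,r_x]$, $x\in X$, now denote the intervals of the canonical representation. For $1\le i\le m-1$ the $i$th gap set is $\mathcal{G}_i=\{x\in X:\ell_x\le i-1\text{ and } i\le r_x\}$, and $\mathcal{G}_0=\mathcal{G}_m=\varnothing$. For $0\le i\le m$ the left- and right-borderline sets are $\mathcal{L}_i=\{x\in X: r_x=i-1\}$ and $\mathcal{R}_i=\{x\in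 X:\ell_x=i\}$ (so $\mathcal{L}_0=\varnothing=\mathcal{R}_m$). A non-empty set $S\subseteq X$ is a fundamental extender if there are an index $0\le i\le m$ and a set $Z$ with $Z\subseteq\mathcal{L}_i$ or $Z\subseteq\mathcal{R}_i$ such that $S=\mathcal{G}_i\cup Z$. $\mathcal{E}_P$ is the collection of all fundamental extenders, and $\overrightarrow{\mathcal{E}_P}\subset\{0,1\}^n$ is the set of their characteristic vectors. A Hilbert basis of a polyhedral cone is a finite set of vectors of the cone such that each integral vector in the cone is a non-negative integral linear combination of vectors from this set; it is integral if all its vectors are integral. *)

(* Defs.v *)
From HB Require Import structures.
From mathcomp Require Import all_boot all_order all_algebra.
From mathcomp Require Import boolp classical_sets cardinality fsbigop reals.

Set Implicit Arguments.
Unset Strict Implicit.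
Unset Printing Implicit Defensive.

Import Order.TTheory GRing.Theory Num.Theory.
Local Open Scope ring_scope.

Section IntervalOrders.
Variables (R : realType) (n : nat).
Implicit Types (prec : rel 'I_n) (x y z : 'I_n).

(* The ground set {1, .., n} is 'I_n; x precedes y when prec x y. *)
Definition interval_order prec : Prop :=
  [/\ irreflexive prec, transitive prec &
      exists l r : 'I_n -> R,
        (forall x, l x <= r x) /\ (forall x y, prec x y = (r x < l y))].

(* Representations in the restricted sense: comparable intervals are at
   distance at least 1. *)
Definition interval_rep prec (l r : 'I_n -> R) : Prop :=
  [/\ forall x, l x <= r x,
      forall x y, prec x y = (r x < l y) &
      forall x y, prec x y -> r x + 1 <= l y].

Definition natural_rep prec (l r : 'I_n -> nat) : Prop :=
  interval_rep prec (fun x => (l x)%:R) (fun x => (r x)%:R).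

Definition downset prec z : {set 'I_n} := [set x | prec x z]%SET.

Definition downsets prec : {set {set 'I_n}} := [set downset prec z | z : 'I_n]%SET.

Definition magnitude prec : nat := #|downsets prec|.

Definition canonical_rep prec (l r : 'I_n -> nat) : Prop :=
  natural_rep prec l r /\
  forall k : nat,
    (exists x, k = l x \/ k = r x) <-> (k < magnitude prec)%N.

Definition length_vec (l r : 'I_n -> R) : 'rV[R]_n := \row_x (r x - l x).

Definition length_polyhedron prec : set 'rV[R]_n :=
  fun v => exists l r, interval_rep prec l r /\ v = length_vec l r.

Definition canonical_length (l r : 'I_n -> nat) : 'rV[R]_n :=
  length_vec (fun x => (l x)%:R) (fun x => (r x)%:R).

(* Q_P translated so that its apex, the length vector of the canonical
   representation (l, r), becomes the origin. *)
Definition length_cone prec (l r : 'I_n -> nat) : set 'rV[R]_n :=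
  fun w => exists2 v, length_polyhedron prec v & w = v - canonical_length l r.

Definition char_vec (S : {set 'I_n}) : 'rV[R]_n := \row_x (x \in S)%:R.

Definition integral_vec (v : 'rV[R]_n) : Prop := forall x, v 0 x \is a Num.int.

Definition hilbert_basis (C B : set 'rV[R]_n) : Prop :=
  [/\ finite_set B,
      (forall b, B b -> C b) &
      forall v, C v -> integral_vec v ->
        exists c : 'rV[R]_n -> nat, v = \sum_(b \in B) (c b)%:R *: b].

Definition integral_hilbert_basis (C B : set 'rV[R]_n) : Prop :=
  hilbert_basis C B /\ (forall b, B b -> integral_vec b).

End IntervalOrders.

Section Extenders.
Variables (n : nat) (m : nat) (l r : 'I_n -> nat).

Definition gap_set (i : nat) : {set 'I_n} :=
  if (0 < i < m)%N then [set x | (l x <= i - 1)%N && (i <= r x)%N]%SET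
  else finset.set0.

(* r x = i - 1 in the integers, so that nothing is left-borderline at 0. *)
Definition left_borderline (i : nat) : {set 'I_n} :=
  [set x | (r x).+1 == i]%SET.

Definition right_borderline (i : nat) : {set 'I_n} :=
  [set x | l x == i]%SET.

Definition fundamental_extender (S : {set 'I_n}) : Prop :=
  S <> finset.set0 /\
  exists (i : nat) (Z : {set 'I_n}),
    [/\ (i <= m)%N,
        Z \subset left_borderline i \/ Z \subset right_borderline i &
        S = (gap_set i :|: Z)%SET].

End Extenders.

Definition extender_vectors (R : realType) (n : nat) (prec : rel 'I_n)
    (l r : 'I_n -> nat) : set 'rV[R]_n :=
  fun v => exists2 S, fundamental_extender (magnitude prec) l r S &
                      v = char_vec R S.

(* The canonical representation always exists: l x counts the down-sets
   strictly below D(x), and r x + 1 those not containing x. *)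
Section CanonicalExists.
Variables (R : realType) (n : nat) (prec : rel 'I_n).
Hypothesis hP : interval_order R prec.

Let Ds := downsets prec.
Let rk (A : {set 'I_n}) := #|[set B in Ds | B \proper A]%SET|.
Let lc (x : 'I_n) := rk (downset prec x).
Let cn (x : 'I_n) := #|[set B in Ds | x \notin B]%SET|.
Let rc (x : 'I_n) := (cn x).-1.

Let inDs x : downset prec x \in Ds. Proof. exact: imset_f. Qed.

Let Ds_chain A B : A \in Ds -> B \in Ds -> (A \subset B) || (B \proper A).
Proof.
case: hP => _ _ [l [r [_ hpr]]] /imsetP[x _ ->] /imsetP[y _ ->].
have sub u v : l u <= l v -> downset prec u \subset downset prec v.
  move=> luv; apply/fintype.subsetP => z; rewrite !inE !hpr => h.
  exact: lt_le_trans h luv.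
case: (boolP (_ \subset _)) => //= nAB; rewrite properE nAB andbT.
by case/orP: (le_total (l x) (l y)) => /sub // h; rewrite h in nAB.
Qed.

Let irr x : x \notin downset prec x.
Proof. by case: hP => h _ _; rewrite inE h. Qed.

Let cn_gt0 x : (0 < cn x)%N.
Proof. by apply/card_gt0P; exists (downset prec x); rewrite inE inDs irr. Qed.

Let rcS x : (rc x).+1 = cn x. Proof. by rewrite prednK. Qed.

Let rk_lt A : A \in Ds -> (rk A < #|Ds|)%N.
Proof.
move=> hA; apply: proper_card; rewrite properE; apply/andP; split.
  by apply/fintype.subsetP => B; rewrite inE => /andP[].
by apply/fintype.subsetPn; exists A => //; rewrite inE fintype.properxx andbF.
Qed.

Let rk_mono (A B : {set 'I_n}) : A \in Ds -> A \proper B -> (rk A < rk B)%N.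
Proof.
move=> hA AB; apply: proper_card; rewrite properE; apply/andP; split.
  apply/fintype.subsetP => C; rewrite !inE => /andP[-> CA] /=.
  exact: fintype.proper_trans CA AB.
by apply/fintype.subsetPn; exists A; rewrite inE hA //= fintype.properxx.
Qed.

Let rk_inj : {in Ds &, injective rk}.
Proof.
move=> A B hA hB e; apply/eqP; rewrite finset.eqEsubset.
have key C D : C \in Ds -> D \in Ds -> rk C = rk D -> C \subset D.
  move=> hC hD eCD; case/orP: (Ds_chain hC hD) => // /(rk_mono hD).
  by rewrite eCD ltnn.
by rewrite !key.
Qed.

Let prec_lt x y : prec x y -> (rc x < lc y)%N.
Proof.
move=> xy; rewrite rcS; apply: subset_leq_card; apply/fintype.subsetP => B.
rewrite !inE => /andP[hB xB]; rewrite hB /=.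
case/orP: (Ds_chain (inDs y) hB) => // /fintype.subsetP/(_ x).
by rewrite inE xy => /(_ isT); rewrite (negPf xB).
Qed.

Let nprec_le x y : ~~ prec x y -> (lc y <= rc x)%N.
Proof.
move=> xy; rewrite -ltnS rcS; apply: proper_card; rewrite properE.
apply/andP; split; last first.
  apply/fintype.subsetPn; exists (downset prec y); rewrite inE inDs /=.
    by rewrite inE.
  by rewrite fintype.properxx.
apply/fintype.subsetP => B; rewrite !inE => /andP[-> /fintype.proper_sub/fintype.subsetP/(_ x) h] /=.
by apply: contra xy => /h; rewrite inE.
Qed.

Lemma canonical_rep_exists :
  exists l r : 'I_n -> nat, canonical_rep R prec l r.
Proof.
have rc_lt x : (rc x < #|Ds|)%N.
  rewrite rcS; apply: subset_leq_card.
  by apply/fintype.subsetP => B; rewrite inE => /andP[].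
exists lc, rc; split; first split.
- by move=> x; rewrite ler_nat nprec_le //; case: hP => ->.
- move=> x y; rewrite ltr_nat; case: (boolP (prec x y)) => [/prec_lt-> //|].
  by move/nprec_le; rewrite leqNgt => /negPf.
- by move=> x y /prec_lt; rewrite natr1 ler_nat.
move=> k; split=> [[x [->|->]]|hk]; [exact: rk_lt | exact: rc_lt |].
pose f (A : {set 'I_n}) : 'I_#|Ds| := insubd (Ordinal hk) (rk A).
have fE A : A \in Ds -> f A = rk A :> nat.
  by move=> hA; rewrite /f val_insubd rk_lt.
have finj : {in Ds &, injective f}.
  by move=> A B hA hB /(congr1 val) /=; rewrite !fE //; exact: rk_inj.
have /eqP fT : (f @: Ds)%SET == [set: 'I_#|Ds|]%SET.
  by rewrite eqEcard finset.subsetT /= (card_in_imset finj) cardsT card_ord.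
have : Ordinal hk \in (f @: Ds)%SET by rewrite fT inE.
case/imsetP => A hA /(congr1 val) /=; rewrite fE // => ->.
by case/imsetP: hA => x _ ->; exists x; left.
Qed.

End CanonicalExists.

(* Main.v *)
Require Import Defs.
From mathcomp Require Import all_boot all_order all_algebra.
From mathcomp Require Import boolp classical_sets cardinality fsbigop reals.
From mathcomp Require Import archimedean zify lra.

(** Fix the canonical representation [(l, r)], with [m] levels [0, .., m-1].

    Every extender vector lies in the cone: inserting one unit of space before
    level [i] of the canonical representation lengthens exactly the intervals
    in the [i]th gap set, and the inserted unit can in addition be given to
    any set of intervals ending at level [i-1], or to any set of intervals
    starting at level [i] ([extender_in_cone]).

    Conversely, the inequalities that say that given integral lengths are
    realized only bound differences of left endpoints by integers, so they
    survive rounding down, and an integral length vector is the length vector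
    of a representation [(a, b)] by natural numbers
    ([natural_rep_of_integral]). Its lengths are the sum, over the unit
    segments [[t-1, t]], of the characteristic vector of the set of intervals
    that contain the segment ([sum_char_step]). Each such set is empty or a
    fundamental extender: for every level [j] the intervals with
    [l x <= j <= r x] still have a common point [c j] in [(a, b)], and a
    segment between [c (i-1)] and [c i] is contained in all intervals of the
    [i]th gap set and otherwise only in intervals ending at level [i-1], or
    only in intervals starting at level [i] ([step_set_extender]). Moreover,
    each gap set of the canonical representation is the set attached to some
    segment, with distinct segments for distinct gaps ([step_set_mark],
    [ltn_mark]). These segments add up to the canonical length vector, and
    the remaining ones express the difference as a sum of extender vectors
    ([natural_rep_span]). *)

Import Order.TTheory GRing.Theory Num.Theory.
Local Open Scope ring_scope.

(** * Natural combinations of a finite set of vectors *)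

(** [v] is a combination of elements of [B] with natural number
    coefficients. *)
Definition nat_span {R : pzRingType} {V : lmodType R} (B : set V) (v : V) :=
  exists c : V -> nat, v = \sum_(b \in B) (c b)%:R *: b.

Lemma nat_span0 {R : pzRingType} {V : lmodType R} (B : set V) : nat_span B 0.
Proof.
by exists (fun=> 0%N); rewrite fsbig1 // => b _; rewrite scale0r.
Qed.

Lemma nat_spanD {R : pzRingType} {V : lmodType R} (B : set V) (u v : V) :
  finite_set B -> nat_span B u -> nat_span B v -> nat_span B (u + v).
Proof.
move=> finB [c ->] [d ->]; exists (fun b => (c b + d b)%N).
rewrite -fsbig_split //=; apply: eq_fsbigr => b _.
by rewrite natrD scalerDl.
Qed.

Lemma nat_span_mem {R : pzRingType} {V : lmodType R} (B : set V) (v : V) :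
  finite_set B -> B v -> nat_span B v.
Proof.
move=> finB Bv; exists (fun b => (b == v) : nat).
rewrite (fsbigD1 v) //= eqxx scale1r fsbig1 ?addr0 // => b [_ /eqP/negPf ->].
by rewrite scale0r.
Qed.

Lemma nat_span_sum {R : pzRingType} {V : lmodType R} (B : set V)
    (I : finType) (P : pred I) (F : I -> V) :
  finite_set B -> (forall i, P i -> nat_span B (F i)) ->
  nat_span B (\sum_(i | P i) F i).
Proof.
move=> finB BF; apply: (big_ind (nat_span B)) => //; first exact: nat_span0.
by move=> u v; apply: nat_spanD.
Qed.

(** * Natural and canonical representations *)

Lemma natural_repP {R : realType} {n : nat} (prec : rel 'I_n)
    (l r : 'I_n -> nat) :
  natural_rep R prec l r <->
  (forall x, l x <= r x)%N /\ (forall x y, prec x y = (r x < l y)%N).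
Proof.
split=> [[lr precE _]|[lr precE]].
  by split=> [x|x y]; [rewrite -(ler_nat R) lr | rewrite precE ltr_nat].
split=> [x|x y|x y]; first by rewrite ler_nat.
  by rewrite ltr_nat precE.
by rewrite natr1 ler_nat precE.
Qed.

Lemma canonical_lt {R : realType} {n : nat} (prec : rel 'I_n)
    (l r : 'I_n -> nat) :
  canonical_rep R prec l r ->
  forall x, (l x < magnitude prec)%N /\ (r x < magnitude prec)%N.
Proof.
by case=> _ vals x; split; apply/vals; exists x; [left|right].
Qed.

(** In the canonical representation every level is both a left and a right
    endpoint. Since [downset prec z] only depends on [l z], the [m] down-sets
    already require [m] distinct left endpoints, and two consecutive left
    endpoints can only have distinct down-sets if a right endpoint separates
    them. *)
Lemma canonical_surj {R : realType} {n : nat} (prec : rel 'I_n)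
    (l r : 'I_n -> nat) :
  canonical_rep R prec l r -> forall k, (k < magnitude prec)%N ->
  (exists y, l y = k) /\ (exists x, r x = k).
Proof.
move=> can; have lt_m := canonical_lt _ _ _ can.
case: can => /natural_repP[lr precE] _.
set m := magnitude prec in lt_m *.
pose lo x : 'I_m := Ordinal (proj1 (lt_m x)).
pose D (k : 'I_m) := [set x | (r x < k)%N]%SET.
pose L := [set lo z | z : 'I_n]%SET.
have DE : downsets prec = (D @: L)%SET.
  rewrite -imset_comp; apply: eq_imset => z /=.
  by apply/setP=> x; rewrite !inE precE.
have cardL : (m <= #|L|)%N.
  by apply: leq_trans (leq_imset_card D L); rewrite -DE.
have LT : L = [set: 'I_m]%SET.
  by apply/eqP; rewrite eqEcard finset.subsetT cardsT card_ord.
have Dinj : {in L &, injective D}.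
  by apply/imset_injP; rewrite -DE LT cardsT card_ord.
have surjl k : (k < m)%N -> exists y, l y = k.
  move=> km; have /imsetP[y _ /(congr1 val) /= ->] : Ordinal km \in L.
    by rewrite LT inE.
  by exists y.
move=> k km; split; first exact: surjl.
have [k1m|mk1] := ltnP k.+1 m; last first.
  have [y ly] := surjl k km; exists y.
  have := lr y; have := (lt_m y).2; lia.
apply: contrapT => nor.
suff : Ordinal km = Ordinal k1m by move/(congr1 val) => /=; lia.
apply: Dinj; rewrite ?LT ?inE //; apply/setP=> x; rewrite !inE /= ltnS [RHS]leq_eqVlt.
by have [rx|//] := eqVneq (r x) k; case: nor; exists x.
Qed.

(** * Unit steps of a natural representation *)

(** The intervals [[l x, r x]] that contain the unit segment [[t-1, t]].
    For [t = 0] there are none, whatever [l] and [r]. *)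
Definition step_set {n : nat} (l r : 'I_n -> nat) (t : nat) : {set 'I_n} :=
  [set x | (l x < t <= r x)%N]%SET.

Lemma sum_step {n : nat} (l r : 'I_n -> nat) (N : nat) (x : 'I_n) :
  (l x <= r x < N)%N -> (\sum_(t < N) (x \in step_set l r t) = r x - l x)%N.
Proof.
move=> /andP[lr rN].
have sumE k : (\sum_(t < k.+1) (x \in step_set l r t) = minn (r x) k - minn (l x) k)%N.
  elim: k => [|k IHk]; first by rewrite big_ord1 inE /=; lia.
  by rewrite big_ord_recr /= IHk inE /=; lia.
by case: N rN => // N rN; rewrite sumE; lia.
Qed.

Lemma sum_char_step {R : realType} {n : nat} (l r : 'I_n -> nat) (N : nat) :
  (forall x, l x <= r x < N)%N ->
  \sum_(t < N) char_vec R (step_set l r t) = canonical_length R l r.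
Proof.
move=> lrN; apply/rowP=> x; rewrite summxE mxE -natrB; last by case/andP: (lrN x).
rewrite -(sum_step _ _ _ _ (lrN x)) natr_sum; apply: eq_bigr => t _.
by rewrite mxE.
Qed.

(** The gap sets of a representation are its own step sets; this includes the
    conventions for the levels [0] and [m]. *)
Lemma gap_setE {n : nat} (m : nat) (l r : 'I_n -> nat) (i : nat) :
  (forall x, r x < m)%N -> gap_set m l r i = step_set l r i.
Proof.
move=> rm; rewrite /gap_set; case: ifP => im; apply/setP=> x; rewrite !inE.
  by lia.
by have := rm x; lia.
Qed.

(** * Extender vectors lie in the cone *)

(** The witness moves every endpoint that is at least [i] one unit to the
    right, except that the elements of [Z] always keep their left endpoint and
    always get their right endpoint moved. *)
Lemma extender_in_cone {R : realType} {n : nat} (prec : rel 'I_n)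
    (l r : 'I_n -> nat) (S : {set 'I_n}) :
  canonical_rep R prec l r -> fundamental_extender (magnitude prec) l r S ->
  length_cone prec l r (char_vec R S).
Proof.
move=> can [_ [i [Z [_ ZLR ->]]]].
have lt_m x := proj2 (canonical_lt _ _ _ can x).
case: can => /natural_repP[lr precE] _.
have Zi x : x \in Z -> ((r x).+1 == i) || (l x == i).
  by case: ZLR => /fintype.subsetP sub /sub; rewrite inE => ->; rewrite ?orbT.
have Zone x y : x \in Z -> y \in Z -> (r x < l y)%N = false.
  have := lr x; have := lr y.
  by case: ZLR => /fintype.subsetP sub ? ? /sub + /sub; rewrite !inE; lia.
pose l' x := (l x + ((i <= l x) && (x \notin Z)))%N.
pose r' x := (r x + ((i <= r x) || (x \in Z)))%N.
have rep' : natural_rep R prec l' r'.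
  apply/natural_repP; split=> [x|x y].
    by rewrite /l' /r'; have := lr x; case: (boolP (x \in Z)); lia.
  have := Zi x; have := Zi y; have := Zone x y; rewrite precE /l' /r'.
  have := lr x; have := lr y.
  by case: (x \in Z); case: (y \in Z); lia.
exists (canonical_length R l' r').
  by exists (fun x => (l' x)%:R), (fun x => (r' x)%:R).
case/natural_repP: rep' => lr' _.
apply/rowP=> x; rewrite !mxE -!natrB //; last first.
  by rewrite /l' /r'; have := lr x; case: (x \in Z); lia.
congr _%:R; rewrite gap_setE // !inE /l' /r'.
by have := Zi x; have := lr x; case: (x \in Z); lia.
Qed.

(** * Step sets are fundamental extenders *)

Section Steps.
Context {n : nat} (m : nat) (l r a b : 'I_n -> nat).
Hypotheses (lr : forall x, (l x <= r x)%N) (rm : forall x, (r x < m)%N).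
Hypotheses (surj_l : forall k, (k < m)%N -> exists y, l y = k)
           (surj_r : forall k, (k < m)%N -> exists x, r x = k).
Hypotheses (same_order : forall x y, (r x < l y)%N = (b x < a y)%N).

Let ab_le x y : (l y <= r x)%N -> (a y <= b x)%N.
Proof. by move=> lyrx; rewrite leqNgt -same_order -leqNgt. Qed.

(** [c j] is a common point of the intervals [[a x, b x]] such that
   [l x <= j <= r x]. *)
Let c (j : nat) := \max_(y | (l y <= j)%N) a y.

Let a_le_c j x : (l x <= j)%N -> (a x <= c j)%N.
Proof. by move=> lj; rewrite /c (leq_bigmax_cond x). Qed.

Let c_le_b j x : (j <= r x)%N -> (c j <= b x)%N.
Proof.
by move=> jr; apply/bigmax_leqP=> y yj; apply: ab_le; exact: leq_trans jr.
Qed.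

(** The extender attached to [t] has the index [i] for which
    [c (i-1) < t <= c i], where a missing [c (-1)] or [c m] imposes no
    constraint. *)
Lemma step_set_extender (t : nat) :
  step_set a b t <> finset.set0 ->
  fundamental_extender m l r (step_set a b t).
Proof.
set S := step_set a b t => S0; split=> //.
have exi : exists i, (i == m) || (t <= c i)%N by exists m; rewrite eqxx.
case: (ex_minnP exi) => i ti imin.
have im : (i <= m)%N by apply: imin; rewrite eqxx.
have c_lt j : (j < i)%N -> (c j < t)%N.
  by move=> ji; rewrite ltnNge; apply/negP=> tj; have := imin j; rewrite tj orbT; lia.
have t_le : (i < m)%N -> (t <= c i)%N by case/orP: ti => [/eqP ->|//]; rewrite ltnn.
have gapS : gap_set m l r i \subset S.
  apply/fintype.subsetP=> x; rewrite gap_setE // !inE => /andP[lxi irx].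
  rewrite (leq_ltn_trans (a_le_c (l x) x _) (c_lt _ lxi)) //=.
  by rewrite (leq_trans (t_le _) (c_le_b _ _ irx)) // (leq_ltn_trans irx).
have borderline x : x \in S -> x \notin gap_set m l r i ->
    ((r x).+1 == i) || (l x == i).
  rewrite gap_setE // !inE => /andP[at_ tb].
  have [lxi|ilx] := ltnP (l x) i; rewrite ?andbT /=.
    (* If [r x < i-1], an interval starting at level [i-1] shows that [x] ends
       before [c (i-1)], hence before the segment. *)
    rewrite -ltnNge => rxi; apply/orP; left; apply/eqP/eqP.
    rewrite eqn_leq rxi /= leqNgt; apply/negP=> rx1i.
    have [|y ly] := surj_l i.-1; first lia.
    have := c_lt i.-1; have := a_le_c i.-1 y; have := same_order x y; lia.
  (* If [l x > i], an interval ending at level [i] shows that [x] starts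
     after [c i], hence after the segment. *)
  move=> _; apply/orP; right; rewrite eqn_leq ilx andbT leqNgt; apply/negP=> ix.
  have im' : (i < m)%N by apply: leq_trans (ltn_trans ix _) (rm x); rewrite ltnS.
  have [y ry] := surj_r i im'.
  have := t_le im'; have := c_le_b i y; have := same_order y x; lia.
pose Z := S :\: gap_set m l r i.
exists i, Z; split=> //; last first.
  apply/setP=> x; rewrite finset.in_setU finset.in_setD.
  by case: (boolP (x \in gap_set m l r i)) => // /(fintype.subsetP gapS).
have [ZL|/fintype.subsetPn[x]] := boolP (Z \subset left_borderline r i).
  by left.
move=> /setDP[xS xG]; rewrite inE => rx; right.
apply/fintype.subsetP=> y /setDP[yS yG]; rewrite inE.
have := borderline x xS xG; rewrite (negPf rx) => /= /eqP lx.
have /orP[/eqP ry|//] := borderline y yS yG.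
(* In [(l, r)], [y] ends before [x] starts, so [y] precedes [x], but both
   contain the segment [[t-1, t]] in [(a, b)]. *)
move: xS yS; rewrite !inE => /andP[ax _] /andP[_ yb].
have := same_order y x; lia.
Qed.

(** The end of the first unit segment that lies after all the intervals
    [[a x, b x]] with [r x < i]. As an empty maximum is [0], [mark 0 = 0],
    whose step set is empty, like the gap set at level [0]. *)
Definition mark (i : nat) := \max_(x | (r x < i)%N) (b x).+1.

Lemma step_set_mark (i : nat) :
  (i < m)%N -> step_set a b (mark i) = step_set l r i.
Proof.
move=> im; apply/setP=> x; rewrite !inE; congr andb.
  apply/idP/idP=> [|lxi].
    rewrite ltnNge; apply: contraNltn => ilx.
    apply/bigmax_leqP=> y ryi; rewrite -same_order; exact: leq_trans ryi ilx.
  have [y ry] := surj_r (l x) (ltn_trans lxi im).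
  apply: leq_trans (leq_bigmax_cond y _); last by rewrite ry.
  by rewrite ltnS; apply: ab_le; rewrite ry.
apply/bigmax_leqP/idP=> [mb|irx y ryi].
  by rewrite leqNgt; apply/negP=> /mb; rewrite ltnn.
have [z lz] := surj_l i im.
by apply: leq_trans (ab_le x z _); rewrite -?same_order lz.
Qed.

Lemma ltn_mark (i j : nat) : (i < j < m)%N -> (mark i < mark j)%N.
Proof.
move=> /andP[ij jm]; have im := ltn_trans ij jm.
have [x rx] := surj_r i im; have [z lz] := surj_l i im.
apply: (@leq_trans (b x).+1); last by apply: leq_bigmax_cond; rewrite rx.
rewrite ltnS; apply/bigmax_leqP=> y ryi.
by apply: leq_trans (ab_le x z _); rewrite -?same_order ?lz ?rx.
Qed.

End Steps.

(** * Integral length vectors *)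

(** The left endpoints are shifted to be nonnegative and then rounded down.
    For a natural number [k], rounding down preserves [u + k <= v] and
    [u <= v + k], hence all the defining inequalities of a representation
    whose lengths are prescribed and integral. *)
Lemma natural_rep_of_integral {R : realType} {n : nat} (prec : rel 'I_n)
    (l r : 'I_n -> R) :
  interval_rep prec l r -> (forall x, r x - l x \is a Num.int) ->
  exists a b : 'I_n -> nat, natural_rep R prec a b /\
    forall x, (b x)%:R - (a x)%:R = r x - l x.
Proof.
move=> [lr precE sep] int_rl.
pose K := (\max_x (Num.truncn `|l x|).+1)%N.
have lK x : 0 <= l x + K%:R.
  have : `|l x| <= K%:R.
    apply: ltW; apply: lt_le_trans (truncnS_gt `|l x|) _.
    by rewrite ler_nat /K (leq_bigmax x).
  by rewrite ler_norml; lra.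
pose a x := Num.truncn (l x + K%:R).
pose w x := Num.truncn (r x - l x).
have wE x : (w x)%:R = r x - l x.
  by rewrite truncnK // natrEint int_rl subr_ge0 lr.
have a_le x : (a x)%:R <= l x + K%:R by rewrite truncn_le.
have a_gt x : l x + K%:R < (a x).+1%:R by rewrite truncnS_gt.
exists a, (fun x => (a x + w x)%N); split; last first.
  by move=> x; rewrite natrD wE; lra.
apply/natural_repP; split=> [x|x y]; first exact: leq_addr.
have [/sep rxly|] := boolP (prec x y).
  apply: esym; rewrite truncn_ge_nat // -natr1 natrD wE.
  by have := a_le x; lra.
rewrite precE -leNgt => lyrx; apply/esym/negbTE; rewrite -leqNgt -ltnS -(ltr_nat R).
by rewrite -addSn natrD wE; have := a_le y; have := a_gt x; lra.
Qed.

Lemma finite_extender_vectors (R : realType) {n : nat} (prec : rel 'I_n)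
    (l r : 'I_n -> nat) : finite_set (extender_vectors (R := R) prec l r).
Proof.
apply: (@sub_finite_set _ _ [set char_vec R S | S in setT]%classic).
  by move=> _ [S _ ->]; exists S.
by apply: finite_image; exact: finite_finset.
Qed.

(** The difference to the canonical length vector is the sum over the unit
    segments that are not marked. *)
Lemma natural_rep_span {R : realType} {n : nat} (prec : rel 'I_n)
    (l r a b : 'I_n -> nat) :
  canonical_rep R prec l r -> natural_rep R prec a b ->
  nat_span (extender_vectors (R := R) prec l r)
    (canonical_length R a b - canonical_length R l r).
Proof.
move=> can /natural_repP[ab precab].
have lt_m x := proj2 (canonical_lt _ _ _ can x).
have surj_l k km := proj1 (canonical_surj _ _ _ can k km).
have surj_r k km := proj2 (canonical_surj _ _ _ can k km).
case: (can) => /natural_repP[lr preclr] _.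
have same x y : (r x < l y)%N = (b x < a y)%N by rewrite -preclr precab.
set m := magnitude prec in lt_m surj_l surj_r.
pose N := (\max_x (b x).+1)%N.
have mark_le i : (mark r b i < N.+1)%N.
  by rewrite ltnS; apply/bigmax_leqP=> x _; rewrite /N (leq_bigmax x).
pose h (i : 'I_m) : 'I_N.+1 := Ordinal (mark_le i).
have h_inj : injective h.
  move=> i j /(congr1 val) /= hij; apply: val_inj => /=.
  have lt_mark := ltn_mark m l r a b surj_l surj_r same.
  have [ij|ji|//] := ltngtP i j.
    by have := lt_mark i j; rewrite ij ltn_ord hij ltnn => /(_ isT).
  by have := lt_mark j i; rewrite ji ltn_ord hij ltnn => /(_ isT).
pose F t := char_vec R (step_set a b t).
have marked : \sum_(t in [set h i | i in 'I_m]%SET) F t = canonical_length R l r.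
  rewrite big_imset /=; last by move=> i j _ _; apply: h_inj.
  rewrite -(sum_char_step l r m) => [|x]; last by rewrite lr lt_m.
  by apply: eq_bigr => i _; rewrite /F (step_set_mark m l r).
rewrite -(sum_char_step a b N.+1) => [|x]; last first.
  by rewrite ab ltnS ltnW // /N (leq_bigmax x).
rewrite (bigID [in [set h i | i in 'I_m]%SET]) /= marked addrAC subrr add0r.
apply: nat_span_sum => [|t _]; first exact: finite_extender_vectors.
have [S0|/eqP S0] := eqVneq (step_set a b t) finset.set0.
  suff -> : char_vec R (step_set a b t) = 0 by apply: nat_span0.
  by apply/rowP=> x; rewrite S0 !mxE inE.
apply: nat_span_mem; first exact: finite_extender_vectors.
exists (step_set a b t) => //.
exact: (step_set_extender m l r a b).
Qed.

Theorem theorem6p1 (R : realType) (n : nat) (prec : rel 'I_n)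
    (l r : 'I_n -> nat)
    (hP : interval_order R prec)
    (hcan : canonical_rep R prec l r) :
  integral_hilbert_basis
    (length_cone (R := R) prec l r)
    (extender_vectors (R := R) prec l r).
Proof.
split; last by move=> _ [S _ ->] x; rewrite mxE intr_nat.
split; first exact: finite_extender_vectors.
  by move=> _ [S fS ->]; apply: extender_in_cone.
move=> v [_ [l' [r' [rep ->]]] ->] int_v.
have [x|a [b [natab abE]]] := natural_rep_of_integral prec l' r' rep.
  have -> : r' x - l' x = (length_vec l' r' - canonical_length R l r) 0 x
      + ((r x)%:R - (l x)%:R) by rewrite !mxE subrK.
  by rewrite rpredD ?int_v // rpredB ?intr_nat.
have -> : length_vec l' r' = canonical_length R a b.
  by apply/rowP=> x; rewrite !mxE abE.
exact: natural_rep_span.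
Qed.
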